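(* Let $X$, $Y$ be real Banach spaces, $\Omega$ a measure space, $Z:=L^2(\Omega)$, and $e:Y\to Z$ a linear continuous dense embedding. Let $f:X\to\mathbb{R}$ and $g:X\to Y$ be continuously Fréchet differentiable. Let $(x^k)$ be generated by the augmented Lagrangian algorithm described in the context, where in Step 2 the iterate $x^{k+1}$ is chosen such that $L_{\rho_k}'(x^{k+1},w^k)\to 0$ in $X^*$, and assume the penalty sequence $(\rho_k)$ is bounded. If $\bar x$ is a (strong) limit point of $(x^k)$, then $\bar x$ is a KKT point of $\min f(x)$ s.t. $g(x)\le 0$ with a multiplier in $Z$: there exists $\lambda\in Z$ with $\lambda\ge 0$ a.e. such that $f'(\bar x)+g'(\bar x)^*\lambda=0$, $g(\bar x)\le 0$, and $\langle\lambda,g(\bar x)\rangle_Z=0$.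
   Context: The order on $Y$ is induced by $Z$: $y\le 0$ means $e(y)\le 0$ a.e. For $z\in Z$, $z_+:=\max\{z,0\}$ pointwise; $\min$ in $Z$ is pointwise; $g'(x)^*$ denotes the adjoint of $e\circ g'(x):X\to Z$ with $Z\cong Z^*$; $\langle\cdot,\cdot\rangle_Z$ is the $L^2$ inner product. The augmented Lagrangian is $L_\rho(x,\lambda):=f(x)+\frac{\rho}{2}\|(g(x)+\lambda/\rho)_+\|_Z^2$, with $x$-derivative $f'(x)+g'(x)^*(\lambda+\rho g(x))_+$. Algorithm: (S.0) Choose $(x^0,\lambda^0)\in X\times Z$, $\rho_0>0$, $w^{\max}\in Z$ with $w^{\max}\ge 0$, $\gamma>1$, $\tau\in(0,1)$; $k=0$. (S.2) Choose $w^k\in Z$ with $0\le w^k\le w^{\max}$ a.e. and compute an approximate minimizer $x^{k+1}$ of $L_{\rho_k}(\cdot,w^k)$. (S.3) Set $\lambda^{k+1}:=(w^k+\rho_k g(x^{k+1}))_+$. If $k=0$ or $\|\min\{-g(x^{k+1}),w^k/\rho_k\}\|_Z\le\tau\|\min\{-g(x^k),w^{k-1}/\rho_{k-1}\}\|_Z$, set $\rho_{k+1}:=\rho_k$; else $\rho_{k+1}:=\gamma\rho_k$. (S.4) $k\leftarrow k+1$, go to (S.2). The algorithm is run without stopping. *)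

(* Defs.v *)
From HB Require Import structures.
From mathcomp Require Import all_boot all_order all_algebra.
From mathcomp Require Import all_classical all_reals all_analysis.
Set Implicit Arguments. Unset Strict Implicit. Unset Printing Implicit Defensive.
Import Order.TTheory GRing.Theory Num.Theory.
Import numFieldNormedType.Exports.
Local Open Scope classical_set_scope.
Local Open Scope ring_scope.

(* Elements of Z = L^2(Omega) are represented by (square-integrable,
   measurable) real functions on Omega; all statements about them are
   made up to mu-a.e. equality. *)

Definition l2norm d (T : measurableType d) (R : realType)
  (mu : {measure set T -> \bar R}) (z : T -> R) : \bar R :=
  Lnorm mu 2%:E (EFin \o z).

Definition inL2 d (T : measurableType d) (R : realType)
  (mu : {measure set T -> \bar R}) (z : T -> R) : Prop :=
  measurable_fun [set: T] z /\ (l2norm mu z < +oo)%E.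

Definition l2inner d (T : measurableType d) (R : realType)
  (mu : {measure set T -> \bar R}) (z1 z2 : T -> R) : R :=
  Rintegral mu [set: T] (fun t => z1 t * z2 t).

Definition ppart (T : Type) (R : realType) (z : T -> R) : T -> R :=
  fun t => Num.max (z t) 0.

Definition dense_embedding d (T : measurableType d) (R : realType)
  (mu : {measure set T -> \bar R}) (Y : normedModType R) (e : Y -> T -> R) : Prop :=
  (forall y, inL2 mu (e y)) /\
  (forall (a b : R) (y1 y2 : Y),
     {ae mu, forall t, e (a *: y1 + b *: y2) t = a * e y1 t + b * e y2 t}) /\
  (exists C : R, forall y, (l2norm mu (e y) <= (C * `|y|)%:E)%E) /\
  (forall y, {ae mu, forall t, e y t = 0} -> y = 0) /\
  (forall z, inL2 mu z -> forall eps : R, 0 < eps ->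
     exists y, (l2norm mu (fun t => (e y t - z t)%R) < eps%:E)%E).

Definition C1 (R : realType) (V W : normedModType R) (f : V -> W) : Prop :=
  (forall x, differentiable f x) /\
  (forall x (eps : R), 0 < eps -> exists2 delta : R, 0 < delta &
     forall x', `|x' - x| < delta ->
       forall h, `|'d f x' h - 'd f x h| <= eps * `|h|).

Definition dLagr d (T : measurableType d) (R : realType)
  (mu : {measure set T -> \bar R}) (X Y : normedModType R) (e : Y -> T -> R)
  (f : X -> R) (g : X -> Y) (rho : R) (x : X) (w : T -> R) (h : X) : R :=
  'd f x h + l2inner mu (ppart (fun t => w t + rho * e (g x) t)) (e ('d g x h)).

(* Main.v *)
(* Boundedness of the penalties makes [rho_k] eventually constant, so the residual [r_k = min(-g(x_{k+1}), w_k/rho)] decays geometrically in [L^2]. Since [lambda_{k+1} = w_k - rho r_k], the safeguarded multipliers [w_k] themselves satisfy the KKT system at the limit point up to errors that vanish along the subsequence.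
   The sets [S_n] of functions in the order interval [0, wmax] that satisfy the KKT system up to [1/(n+1)] are therefore nonempty; they are convex and decreasing. Nearly norm-minimal elements of [S_n] form, by the parallelogram law, a fast Cauchy sequence, which converges almost everywhere and is dominated by [wmax]; its limit is an exact multiplier. This replaces the weak sequential compactness of bounded sets in [L^2] and needs no assumption on the measure space. *)
Require Import Defs.
From HB Require Import structures.
From mathcomp Require Import all_boot all_order all_algebra.
From mathcomp Require Import all_classical all_reals all_analysis.
From mathcomp Require Import measurable_realfun ring lra.
Set Implicit Arguments.
Unset Strict Implicit.
Import Order.TTheory GRing.Theory Num.Theory.
Import numFieldNormedType.Exports.
Local Open Scope classical_set_scope.
Local Open Scope ring_scope.

(** * Calculus of real-valued $L^2$ functions: norm, inner product, Cauchy-Schwarz *)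

Section L2.
Context {d : measure_display} {T : measurableType d} {R : realType}.
Context (mu : {measure set T -> \bar R}).
Implicit Types (a b c z : T -> R) (k : R).

(** [fine] sends an infinite norm to 0, so this value is meaningful only under [inL2]. *)
Definition L2norm z : R := fine (l2norm mu z).

Lemma inL2_Lfun z : inL2 mu z <-> z \in Lfun mu 2%:E.
Proof.
rewrite inE /= /inL2; split => [[mz fz]|/andP[]].
  by apply/andP; split; rewrite inE.
by rewrite !inE.
Qed.

Lemma inL2_measurable z : inL2 mu z -> measurable_fun [set: T] z.
Proof. by case. Qed.

Lemma inL2D a b : inL2 mu a -> inL2 mu b -> inL2 mu (fun t => a t + b t).
Proof.
move=> /inL2_Lfun ha /inL2_Lfun hb; apply/inL2_Lfun.
exact: (Lfun_addr_closed mu (lee1n 2)).2 _ _ ha hb.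
Qed.

Lemma inL2Z k a : inL2 mu a -> inL2 mu (fun t => k * a t).
Proof.
move=> /inL2_Lfun ha; apply/inL2_Lfun.
have r12 : 1 <= 2 :> R by rewrite ler1n.
rewrite (_ : (fun t => k * a t) = k \o* a); first exact: Lfun_scale.
by apply/funext => t /=; rewrite mulrC.
Qed.

Lemma inL2B a b : inL2 mu a -> inL2 mu b -> inL2 mu (fun t => a t - b t).
Proof.
move=> ha hb; have := inL2D ha (inL2Z (-1) hb).
by congr inL2; apply/funext => t; rewrite mulN1r.
Qed.

Lemma le_l2norm a b : measurable_fun [set: T] a -> measurable_fun [set: T] b ->
  {ae mu, forall t, `|a t| <= `|b t|} -> (l2norm mu a <= l2norm mu b)%E.
Proof.
move=> ma mb ab; rewrite /l2norm unlock.
have m2 (c : T -> R) : measurable_fun [set: T] c ->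
    measurable_fun [set: T] (fun t => (`|(EFin \o c) t| `^ 2)%E).
  move=> mc; apply/measurable_EFinP.
  apply: (@measurableT_comp _ _ _ _ _ _ (fun x : R => x `^ 2)%R) => //.
  exact: measurableT_comp.
apply: gt0_ler_poweR => //.
- by rewrite in_itv/= leey integral_ge0.
- by rewrite in_itv/= leey integral_ge0.
apply: ae_ge0_le_integral => //; try exact: m2; try by move=> t _; exact: poweR_ge0.
apply: filterS ab => t abt _ /=.
by rewrite lee_fin ge0_ler_powR// nnegrE.
Qed.

Lemma inL2_le a b : measurable_fun [set: T] a -> inL2 mu b ->
  {ae mu, forall t, `|a t| <= `|b t|} -> inL2 mu a.
Proof.
move=> ma [mb fb] ab; split => //.
exact: le_lt_trans (le_l2norm ma mb ab) fb.
Qed.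

Lemma inL2_norm a : inL2 mu a -> inL2 mu (fun t => `|a t|).
Proof.
move=> ha; apply: (inL2_le _ ha); last by apply: aeW => t; rewrite normr_id.
by apply: measurableT_comp => //; exact: inL2_measurable.
Qed.

Lemma L2normE z : inL2 mu z -> (L2norm z)%:E = l2norm mu z.
Proof. by move=> [_ fz]; rewrite /L2norm fineK// ge0_fin_numE// Lnorm_ge0. Qed.

Lemma L2norm_ge0 z : 0 <= L2norm z.
Proof. by rewrite fine_ge0// Lnorm_ge0. Qed.

Lemma le_L2norm a b : measurable_fun [set: T] a -> inL2 mu b ->
  {ae mu, forall t, `|a t| <= `|b t|} -> L2norm a <= L2norm b.
Proof.
move=> ma hb ab; rewrite -lee_fin !L2normE//; last exact: inL2_le hb ab.
by apply: le_l2norm => //; exact: inL2_measurable.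
Qed.

Lemma ler_L2normD a b : inL2 mu a -> inL2 mu b ->
  L2norm (fun t => a t + b t) <= L2norm a + L2norm b.
Proof.
move=> ha hb; rewrite -lee_fin EFinD !L2normE//; last exact: inL2D.
by apply: eminkowski; [exact: inL2_measurable|exact: inL2_measurable|exact: lee1n].
Qed.

Lemma L2norm_eq0 a : inL2 mu a -> L2norm a = 0 -> {ae mu, forall t, a t = 0}.
Proof.
move=> ha a0; have : l2norm mu a = 0%E by rewrite -L2normE// a0.
move/Lnorm_eq0_eq0 => a00; have : (EFin \o a) = \0%E %[ae mu].
  apply: a00; last by rewrite lte_fin.
  by apply/measurable_EFinP; exact: inL2_measurable.
by apply: filterS => t /= /(_ I) [].
Qed.

Lemma inL2_integrableM a b : inL2 mu a -> inL2 mu b ->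
  mu.-integrable [set: T] (EFin \o (fun t => a t * b t)).
Proof.
move=> /inL2_Lfun ha /inL2_Lfun hb.
exact/Lfun1_integrable/(Lfun2_mul_Lfun1 ha hb).
Qed.

Lemma l2innerDl a b z : inL2 mu a -> inL2 mu b -> inL2 mu z ->
  l2inner mu (fun t => a t + b t) z = l2inner mu a z + l2inner mu b z.
Proof.
move=> ha hb hz; rewrite /l2inner -RintegralD//; try exact: inL2_integrableM.
by apply: eq_Rintegral => t _; rewrite mulrDl.
Qed.

Lemma l2innerZl k a z : inL2 mu a -> inL2 mu z ->
  l2inner mu (fun t => k * a t) z = k * l2inner mu a z.
Proof.
move=> ha hz; rewrite /l2inner -RintegralZl//; try exact: inL2_integrableM.
by apply: eq_Rintegral => t _; rewrite mulrA.
Qed.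

Lemma l2innerC a b : l2inner mu a b = l2inner mu b a.
Proof. by apply: eq_Rintegral => t _; rewrite mulrC. Qed.

Lemma ae_eq_l2innerr a b c : inL2 mu a -> inL2 mu b -> inL2 mu c ->
  {ae mu, forall t, b t = c t} -> l2inner mu a b = l2inner mu a c.
Proof.
move=> ha hb hc bc; rewrite /l2inner /Rintegral; congr fine.
apply: ae_eq_integral => //.
- by have /integrableP[] := inL2_integrableM ha hb.
- by have /integrableP[] := inL2_integrableM ha hc.
- by apply: filterS bc => t /= -> _.
Qed.

(** Hölder's inequality with exponents 2 and 2. The absolute value stays inside the integral, as is
    needed for sums of products and for products dominated pointwise. *)
Lemma cauchy_schwarz_L2 a b : inL2 mu a -> inL2 mu b ->
  \int[mu]_t `|a t * b t| <= L2norm a * L2norm b.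
Proof.
move=> ha hb; have iab := integrable_norm (inL2_integrableM ha hb).
rewrite -lee_fin EFinM !L2normE// /Rintegral fineK ?integrable_fin_num//.
rewrite /l2norm; apply: le_trans.
  2: apply: (hoelder mu (inL2_measurable ha) (inL2_measurable hb)) => //.
  by rewrite Lnorm1.
by rewrite [RHS]splitr !div1r.
Qed.

Lemma ler_norm_l2inner a b : inL2 mu a -> inL2 mu b ->
  `|l2inner mu a b| <= L2norm a * L2norm b.
Proof.
move=> ha hb; apply: le_trans (cauchy_schwarz_L2 ha hb).
by apply: le_normr_Rintegral => //; exact: inL2_integrableM.
Qed.

Lemma L2norm_sqr a : inL2 mu a -> L2norm a ^+ 2 = l2inner mu a a.
Proof.
move=> ha; apply: EFin_inj; rewrite EFin_expe L2normE// /l2inner /Rintegral.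
rewrite fineK; last exact/integrable_fin_num/inL2_integrableM.
have <- : (l2norm mu a `^ 2)%E = (l2norm mu a ^+ 2)%E.
  by rewrite -L2normE// poweR_EFin powR_mulrn ?L2norm_ge0// EFin_expe.
rewrite /l2norm poweR_Lnorm; last by rewrite pnatr_eq0.
apply: eq_integral => t _ /=.
by rewrite powR_mulrn// real_normK ?num_real// expr2.
Qed.

End L2.

(** * Weak limits selected from decreasing convex subsets of an order interval *)

Section weak_limit.
Context {d : measure_display} {T : measurableType d} {R : realType}.
Context {mu : {measure set T -> \bar R}}.

Lemma inL2_order_interval (v W : T -> R) : inL2 mu W ->
  measurable_fun [set: T] v -> {ae mu, forall t, 0 <= v t <= W t} -> inL2 mu v.
Proof.
move=> hW mv vW; apply: inL2_le hW _ => //; apply: filterS vW => t /andP[v0 vW].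
by rewrite ger0_norm// ger0_norm// (le_trans v0).
Qed.

(* The weight [W] makes [\sum_n |v_(n+1) - v_n| W] integrable on any measure space, by Cauchy-Schwarz. *)
Lemma ae_cvg_order_interval (v : nat -> T -> R) (W : T -> R) : inL2 mu W ->
  (forall n, measurable_fun [set: T] (v n)) ->
  (forall n, {ae mu, forall t, 0 <= v n t <= W t}) ->
  (forall n, L2norm mu (fun t => v n.+1 t - v n t) <= (2 ^ n.+1)%:R^-1) ->
  {ae mu, forall t, cvgn (v^~ t)}.
Proof.
move=> hW mv vW dv.
have hv n : inL2 mu (v n) by exact: inL2_order_interval hW (mv n) (vW n).
pose D n t := v n.+1 t - v n t.
have hD n : inL2 mu (D n) by exact: inL2B.
pose F t := (\sum_(n <oo) (`|D n t * W t|)%:E)%E.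
have mF n : measurable_fun [set: T] (fun t => (`|D n t * W t|)%:E).
  apply/measurable_EFinP; apply: measurableT_comp => //.
  exact: measurable_funM (inL2_measurable (hD n)) (inL2_measurable hW).
have F0 t : (0 <= F t)%E by apply: nneseries_ge0 => n _ _; exact: normr_ge0.
have Fy : (\int[mu]_t F t < +oo)%E.
  (* The rate $2^{-(n+1)}$ sums to 1, so the integral of [F] is at most the norm of [W]. *)
  rewrite integral_nneseries//; apply: le_lt_trans (ltry (L2norm mu W)).
  apply: le_trans (epsilon_trick0 xpredT (L2norm_ge0 mu W)).
  apply: lee_nneseries => [i _ _|n _]; first by apply: integral_ge0.
  have := cauchy_schwarz_L2 (hD n) hW; rewrite -lee_fin /Rintegral fineK; last first.
    exact/integrable_fin_num/integrable_norm/inL2_integrableM.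
  move/le_trans; apply.
  by rewrite lee_fin mulrC ler_wpM2l ?L2norm_ge0// dv.
have iF : mu.-integrable [set: T] F.
  apply/integrableP; split; first exact: ge0_emeasurable_sum.
  by under eq_integral do rewrite gee0_abs//.
apply: filterS2 (integrable_ae measurableT iF) (ae_foralln vW) => t /(_ I) Ft vWt.
have /andP[v0 v0W] := vWt 0%N.
(* Where [W t = 0] the weighted series says nothing, but there every [v n t] is 0; where [W t > 0]
   the weight can be divided out. *)
have := le_trans v0 v0W; rewrite le_eqVlt => /predU1P[W0|W0].
  rewrite (_ : v^~ t = cst 0); first exact: is_cvg_cst.
  by apply/funext => n; apply/eqP; rewrite eq_le; have := vWt n; rewrite -W0 andbC.
suff cD : cvgn (series (telescope (v^~ t))).
  rewrite (_ : v^~ t = (fun n => v 0%N t + series (telescope (v^~ t)) n)).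
    by apply: is_cvgD => //; exact: is_cvg_cst.
  by apply/funext => n; rewrite -(eq_sum_telescope (v^~ t)).
apply: normed_cvg; apply: nondecreasing_is_cvgn.
  by apply: nondecreasing_series => n _ _; exact: normr_ge0.
exists (fine (F t) / W t) => _ [n _ <-].
rewrite ler_pdivlMr// -lee_fin fineK//.
apply: le_trans (nneseries_lim_ge n _); last by move=> k _ _; exact: normr_ge0.
rewrite sumEFin lee_fin /series /= mulr_suml; apply: ler_sum => k _.
by rewrite normrM (ger0_norm (ltW W0)).
Qed.

(** Dominated convergence with majorant [|W z|], integrable as a product of two $L^2$ functions. *)
Lemma dominated_cvg_l2inner (v : nat -> T -> R) (lam W z : T -> R) :
  inL2 mu W -> inL2 mu z -> (forall n, measurable_fun [set: T] (v n)) ->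
  measurable_fun [set: T] lam ->
  (forall n, {ae mu, forall t, 0 <= v n t <= W t}) ->
  {ae mu, forall t, v n t @[n --> \oo] --> lam t} ->
  l2inner mu (v n) z @[n --> \oo] --> l2inner mu lam z.
Proof.
move=> hW hz mv mlam vW vlam.
have iWz := integrable_norm (inL2_integrableM hW hz).
have mz := inL2_measurable hz.
have [] := @dominated_convergence _ _ _ mu setT measurableT
  (fun n t => (v n t * z t)%:E) (fun t => (lam t * z t)%:E)
  (fun t => (`|W t * z t|)%:E) _ _ _ iWz _.
- by move=> n; apply/measurable_EFinP; exact: measurable_funM.
- by apply/measurable_EFinP; exact: measurable_funM.
- apply: filterS vlam => t vt _; apply: cvg_EFin; first exact: nearW.
  by apply: cvgM => //; exact: cvg_cst.
- apply: filterS (ae_foralln vW) => t vWt n _; rewrite lee_fin !normrM.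
  have /andP[v0 vWn] := vWt n.
  by rewrite ler_wpM2r// ger0_norm// ger0_norm// (le_trans v0).
move=> ilz _ cvz; apply: fine_cvg.
by rewrite fineK; [exact: cvz|exact: integrable_fin_num].
Qed.

(** The upper limit is defined and measurable everywhere, including the null set where [v n t]
    diverges, and agrees with the limit elsewhere. *)
Lemma measurable_ae_limit (v : nat -> T -> R) :
  (forall n, measurable_fun [set: T] (v n)) -> {ae mu, forall t, cvgn (v^~ t)} ->
  exists2 lam : T -> R, measurable_fun [set: T] lam &
    {ae mu, forall t, v n t @[n --> \oo] --> lam t}.
Proof.
move=> mv cv; exists (fun t => fine (limn_esup (fun n => (v n t)%:E))).
  apply: measurableT_comp => //; apply: measurable_fun_limn_esup => n.
  exact/measurable_EFinP.
apply: filterS cv => t /cvg_ex[/= l vl].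
have vlE : (v n t)%:E @[n --> \oo] --> l%:E by apply: cvg_EFin => //; exact: nearW.
rewrite is_cvg_limn_esupE; last by apply/cvg_ex; exists l%:E.
by rewrite (cvg_lim _ vlE).
Qed.

(* Nearly norm-minimal elements of a decreasing sequence of midpoint-convex sets: the parallelogram law makes them fast Cauchy. *)
Lemma fast_cauchy_selection (S : nat -> set (T -> R)) (W : T -> R) : inL2 mu W ->
  (forall n v, S n v ->
     measurable_fun [set: T] v /\ {ae mu, forall t, 0 <= v t <= W t}) ->
  (forall m n, (m <= n)%N -> S n `<=` S m) ->
  (forall n a b, S n a -> S n b -> S n (fun t => 2^-1 * (a t + b t))) ->
  (forall n, S n !=set0) ->
  exists v : nat -> T -> R, (forall n, S n (v n)) /\
    forall n, L2norm mu (fun t => v n.+1 t - v n t) <= (2 ^ n.+1)%:R^-1.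
Proof.
move=> hW SW Sdec Smid S0.
have hS n v : S n v -> inL2 mu v by move=> /SW[mv vW]; exact: inL2_order_interval hW mv vW.
pose q (v : T -> R) := l2inner mu v v.
have q0 v : 0 <= q v by apply: Rintegral_ge0 => t _; exact: sqr_ge0.
(* Squared distance from 0 to [S n]. It increases with [n], since the sets shrink, and is bounded by
   the squared norm of [W]; [D] below is therefore its limit. *)
pose dist n := inf (q @` S n).
have has_infS n : has_inf (q @` S n).
  split; first by have [v Sv] := S0 n; exists (q v), v.
  by exists 0 => _ [v _ <-].
have dist_le n v : S n v -> dist n <= q v.
  by move=> Sv; apply: ge_inf; [exact: (has_infS n).2|exists v].
have dist_mono m n : (m <= n)%N -> dist m <= dist n.
  move=> mn; apply: lb_le_inf; first exact: (has_infS n).1.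
  by move=> _ [v Sv <-]; apply: dist_le; exact: Sdec mn _ Sv.
have has_supd : has_sup (range dist).
  split; first by exists (dist 0%N), 0%N.
  exists (L2norm mu W ^+ 2) => _ [n _ <-]; have [v Sv] := S0 n.
  apply: (le_trans (dist_le n v Sv)).
  have [mv vW] := SW n v Sv.
  rewrite /q -L2norm_sqr; last exact: hS Sv.
  rewrite ler_sqr ?nnegrE ?L2norm_ge0//; apply: le_L2norm => //.
  apply: filterS vW => t /andP[v0 vWt].
  by rewrite ger0_norm// ger0_norm// (le_trans v0).
pose D := sup (range dist).
(* The parallelogram law will bound the squared gap by [6 * eps n + 2 * eps n.+1], hence by
   [8 * eps n], the square of the required rate. *)
pose eps n : R := (2 ^ n.+1)%:R^-1 ^+ 2 / 8.
have eps_gt0 n : 0 < eps n.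
  by rewrite divr_gt0// exprn_gt0// invr_gt0 ltr0n expn_gt0.
have eps_mono n : eps n.+1 <= eps n.
  rewrite ler_pM2r ?invr_gt0// ler_sqr ?nnegrE ?invr_ge0//.
  by rewrite lef_pV2 ?posrE ?ltr0n ?expn_gt0// ler_nat leq_exp2l.
(* The element is taken from a later set [S K], with [K >= n] so large that [dist K] is within
   [eps n] of [D]. *)
have near_min n : exists vK : (T -> R) * nat, [/\ (n <= vK.2)%N, S vK.2 vK.1,
    q vK.1 < D + eps n & forall u, S vK.2 u -> D - eps n < q u].
  have [_ [k _ <-] Dk] := sup_adherent (eps_gt0 n) has_supd.
  pose K := maxn n k.
  have [_ [v Sv <-] qv] := inf_adherent (eps_gt0 n) (has_infS K).
  exists (v, K); split => //=; first exact: leq_maxl.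
    apply: (lt_le_trans qv); rewrite lerD2r; apply: ub_le_sup; first exact: has_supd.2.
    by exists K.
  move=> u /dist_le; apply: lt_le_trans; apply: (lt_le_trans Dk).
  by apply: dist_mono; exact: leq_maxr.
have [vK vKP] := choice near_min.
exists (fun n => (vK n).1); split => n.
  by have [nK Sv _ _] := vKP n; exact: Sdec nK _ Sv.
have [_ Sa qa ua] := vKP n; have [_ Sb qb ub] := vKP n.+1.
move: (vK n) (vK n.+1) Sa qa ua Sb qb ub => [a Ka] [b Kb] /= Sa qa ua Sb qb ub.
have ha := hS _ _ Sa; have hb := hS _ _ Sb; have hD := inL2B hb ha.
(* [Ka] and [Kb] may come in either order; the midpoint lies in the larger of the two sets, whose
   lower bound applies. *)
have qmid : D - eps n < q (fun t => 2^-1 * (b t + a t)).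
  have [KK|/ltnW KK] := leqP Ka Kb.
    by apply: ua; apply: Smid => //; exact: Sdec KK _ Sb.
  apply: le_lt_trans (ub _ (Smid _ _ _ Sb (Sdec _ _ KK _ Sa))).
  by rewrite lerD2l lerN2.
have parallelogram : q (fun t => b t - a t) + 4 * q (fun t => 2^-1 * (b t + a t))
    = 2 * q a + 2 * q b.
  have E (k l : R) : q (fun t => k * b t + l * a t)
      = k ^+ 2 * q b + 2 * k * l * l2inner mu b a + l ^+ 2 * q a.
    have hk := inL2Z k hb; have hl := inL2Z l ha; have hkl := inL2D hk hl.
    rewrite /q l2innerDl// !l2innerZl// ![l2inner mu _ (fun _ => _ + _)]l2innerC.
    rewrite !l2innerDl// !l2innerZl// (l2innerC mu a b); ring.
  have -> : (fun t => b t - a t) = (fun t => 1 * b t + (-1) * a t).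
    by apply/funext => t; rewrite mul1r mulN1r.
  have -> : (fun t => 2^-1 * (b t + a t)) = (fun t => 2^-1 * b t + 2^-1 * a t).
    by apply/funext => t; rewrite mulrDr.
  by rewrite !E; field.
rewrite -ler_sqr ?nnegrE ?L2norm_ge0 ?invr_ge0// L2norm_sqr// -/(q _).
have -> : (2 ^ n.+1)%:R^-1 ^+ 2 = 8 * eps n by rewrite /eps mulrC divfK// pnatr_eq0.
have := eps_mono n; lra.
Qed.

(** The selected sequence converges weakly, so bounds on inner products that hold along [S n] pass
    to [lam]. *)
Lemma order_interval_weak_limit (S : nat -> set (T -> R)) (W : T -> R) : inL2 mu W ->
  (forall n v, S n v ->
     measurable_fun [set: T] v /\ {ae mu, forall t, 0 <= v t <= W t}) ->
  (forall m n, (m <= n)%N -> S n `<=` S m) ->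
  (forall n a b, S n a -> S n b -> S n (fun t => 2^-1 * (a t + b t))) ->
  (forall n, S n !=set0) ->
  exists (lam : T -> R) (v : nat -> T -> R),
    [/\ measurable_fun [set: T] lam, {ae mu, forall t, 0 <= lam t <= W t},
        forall n, S n (v n) &
        forall z, inL2 mu z -> l2inner mu (v n) z @[n --> \oo] --> l2inner mu lam z].
Proof.
move=> hW SW Sdec Smid S0.
have [v [Sv dv]] := fast_cauchy_selection hW SW Sdec Smid S0.
have mv n := (SW n _ (Sv n)).1; have vW n := (SW n _ (Sv n)).2.
have [lam mlam vlam] := measurable_ae_limit mv (ae_cvg_order_interval hW mv vW dv).
exists lam, v; split => //; last first.
  by move=> z hz; exact: dominated_cvg_l2inner hW hz mv mlam vW vlam.
apply: filterS2 (ae_foralln vW) vlam => t vWt vl; apply/andP; split.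
  by apply: ler_cvg_to (cvg_cst 0) vl _; apply: nearW => n; have /andP[] := vWt n.
by apply: ler_cvg_to vl (cvg_cst (W t)) _; apply: nearW => n; have /andP[] := vWt n.
Qed.

End weak_limit.

(** * Penalty and residual sequences, and pointwise inequalities for the residual *)

Section real_sequences.
Context {R : realType}.

(** Once a term exceeds the supremum divided by [gamma], one more multiplication by [gamma] would
    exceed the supremum. *)
Lemma bounded_growth_stationary (rho : nat -> R) (gamma : R) : 0 < rho 0%N ->
  1 < gamma -> (forall k, rho k.+1 = rho k \/ rho k.+1 = gamma * rho k) ->
  (exists M : R, forall k, rho k <= M) ->
  exists (K : nat) (r : R), 0 < r /\ forall k, (K <= k)%N -> rho k = r.
Proof.
move=> rho0 g1 step [M rhoM].
have rho_gt0 k : 0 < rho k.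
  by elim: k => // k IH; case: (step k) => ->//; rewrite mulr_gt0// (lt_trans ltr01).
have rho_step k : rho k <= rho k.+1.
  by case: (step k) => ->//; rewrite ler_peMl ?ltW.
have rho_mono : {homo rho : m n / (m <= n)%N >-> m <= n}.
  exact: homo_leq lexx le_trans rho_step.
have hs : has_sup (range rho).
  by split; [exists (rho 0%N), 0%N|exists M => _ [k _ <-]].
have sup_gt0 : 0 < sup (range rho).
  by apply: (lt_le_trans rho0); apply: (ub_le_sup hs.2); exists 0%N.
have eps_gt0 : 0 < sup (range rho) - sup (range rho) / gamma.
  by rewrite subr_gt0 ltr_pdivrMr ?(lt_trans ltr01)// ltr_pMr.
have [_ [K _ <-]] := sup_adherent eps_gt0 hs.
rewrite subKr ltr_pdivrMr ?(lt_trans ltr01)// => supK.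
exists K, (rho K); split => // k Kk.
have : forall j, rho (j + K)%N = rho K.
  elim=> // j IH; rewrite addSn; case: (step (j + K)%N); rewrite IH// => rhoS.
  have : rho (j + K).+1 <= sup (range rho).
    by apply: (ub_le_sup hs.2); exists (j + K).+1.
  by rewrite rhoS mulrC leNgt supK.
by move=> /(_ (k - K)%N); rewrite subnK.
Qed.

Lemma linear_decay_lt (u : nat -> R) (tau : R) (K : nat) : 0 < tau < 1 ->
  (forall k, (K <= k)%N -> u k.+1 <= tau * u k) ->
  forall eps, 0 < eps -> \forall k \near \oo, u k < eps.
Proof.
move=> /andP[t0 t1] step eps e0.
have geo n : u (n + K)%N <= geometric (u K) tau n.
  elim: n => [|n IH]; first by rewrite /= expr0 mulr1.
  apply: le_trans (step _ (leq_addl _ _)) _.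
  by rewrite /= exprS mulrCA ler_pM2l.
have : geometric (u K) tau n @[n --> \oo] --> 0.
  by apply: cvg_geometric; rewrite ger0_norm// ltW.
move=> /cvgrPdist_lt/(_ _ e0)[N _ HN].
exists (N + K)%N => // k /= NKk.
have -> : k = (k - K + K)%N by rewrite subnK// (leq_trans (leq_addl _ _) NKk).
apply: (le_lt_trans (geo _)).
have /HN /= : (N <= k - K)%N by rewrite leq_subRL ?(leq_trans (leq_addl _ _) NKk)// addnC.
by rewrite sub0r normrN => /(le_lt_trans (ler_norm _)).
Qed.

Lemma harmonic_bound_cvg_eq0 (u : nat -> R) (l c : R) : u n @[n --> \oo] --> l ->
  (forall n, `|u n| <= n.+1%:R^-1 * c) -> l = 0.
Proof.
move=> ul uc; apply/eqP; rewrite -normr_le0.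
have hc : (n.+1%:R^-1 * c : R) @[n --> \oo] --> 0.
  by rewrite -(mul0r c); apply: cvgM; [exact: cvg_harmonic|exact: cvg_cst].
by apply: ler_cvg_to (cvg_norm ul) hc _; exact: nearW.
Qed.

(** Pointwise form of $\lambda^{k+1} = w^k - \rho r_k$: the updated multiplier differs from the
    safeguarded one by a multiple of the residual. *)
Lemma maxr_sub_minr (G w r : R) : 0 < r ->
  Num.max (w + r * G) 0 = w - r * Num.min (- G) (w / r).
Proof.
move=> r0; rewrite minr_pMr ?ltW// mulrN mulrCA divff ?gt_eqF// mulr1.
by rewrite oppr_min opprK addr_maxr subrr.
Qed.

(** If [G <= 0], then [Gb <= Gb - G]. If [G > 0], the minimum is [- G], so the residual measures the
    violation [G] itself. *)
Lemma positive_part_le_residual (G Gb w r : R) : 0 < r -> 0 <= w ->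
  Num.max Gb 0 <= `|Num.min (- G) (w / r)| + `|G - Gb|.
Proof.
move=> r0 w0; have wr0 : 0 <= w / r by rewrite divr_ge0// ltW.
rewrite ge_max addr_ge0// andbT.
have := ler_norm (- (G - Gb)); rewrite normrN.
have [G0|G0] := leP G 0; first by have := normr_ge0 (Num.min (- G) (w / r)); lra.
by rewrite (min_idPl _) ?normrN ?(gtr0_norm G0); lra.
Qed.

(** The minimum is 1-Lipschitz in its first argument, so [G] may be replaced by [Gb] at cost
    [|G - Gb|]. The product [w * |Gb|] is then the minimum of [- Gb] and [w / r] times either [w] or
    [r * |Gb|], and the second factor bounds both. *)
Lemma complementarity_le_residual (G Gb w W r : R) : 0 < r -> Gb <= 0 -> 0 <= w <= W ->
  `|w * Gb| <= (`|Num.min (- G) (w / r)| + `|G - Gb|) * (r * `|Gb| + W).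
Proof.
move=> r0 Gb0 /andP[w0 wW]; have wr0 : 0 <= w / r by rewrite divr_ge0// ltW.
have mle : Num.min (- Gb) (w / r) <= `|Num.min (- G) (w / r)| + `|G - Gb|.
  have := ler_norm (G - Gb); have := ler_norm (Num.min (- G) (w / r)).
  have := normr_ge0 (G - Gb).
  case: (leP (- G) (w / r)) => _ h1 h2 h3; rewrite ge_min; apply/orP; [left|right]; lra.
have B0 : 0 <= r * `|Gb| + W by rewrite addr_ge0 ?mulr_ge0 ?(ltW r0)// (le_trans w0).
apply: le_trans (ler_wpM2r B0 mle).
rewrite normrM (ger0_norm w0) (ler0_norm Gb0).
have W0 := le_trans w0 wW.
case: (leP (- Gb) (w / r)) => _.
  by rewrite mulrC ler_wpM2l ?oppr_ge0// (le_trans wW)// lerDr mulr_ge0 ?oppr_ge0// ltW.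
by rewrite mulrDr mulrA divfK ?gt_eqF// lerDl mulr_ge0.
Qed.

End real_sequences.

(** * Square integrability of the residual and of positive parts *)

Section residual.
Context {d : measure_display} {T : measurableType d} {R : realType}.
Context (mu : {measure set T -> \bar R}).

(** Only the products are compared: in the complementarity estimate the small factor [A] need not
    dominate either factor on the left. *)
Lemma ler_norm_l2inner_dom (a b A B : T -> R) : inL2 mu a -> inL2 mu b ->
  inL2 mu A -> inL2 mu B -> {ae mu, forall t, `|a t * b t| <= `|A t * B t|} ->
  `|l2inner mu a b| <= L2norm mu A * L2norm mu B.
Proof.
move=> ha hb hA hB abAB; apply: le_trans (cauchy_schwarz_L2 hA hB).
have iab := inL2_integrableM ha hb; have iAB := integrable_norm (inL2_integrableM hA hB).
apply: le_trans (le_normr_Rintegral measurableT iab) _.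
rewrite /Rintegral fine_le ?integrable_fin_num//; first exact: integrable_norm.
have /integrableP[m1 _] := integrable_norm iab; have /integrableP[m2 _] := iAB.
apply: ae_ge0_le_integral => //.
by apply: filterS abAB => t abt _; rewrite lee_fin.
Qed.

Lemma inL2_minr (a b : T -> R) : inL2 mu a -> inL2 mu b ->
  inL2 mu (fun t => Num.min (a t) (b t)).
Proof.
move=> ha hb; apply: (inL2_le _ (inL2D (inL2_norm ha) (inL2_norm hb))).
  exact: measurable_minr (inL2_measurable ha) (inL2_measurable hb).
apply: aeW => t; rewrite [leRHS]ger0_norm; last by rewrite addr_ge0.
by case: (leP (a t) (b t)) => _; rewrite ?lerDl ?lerDr.
Qed.

Lemma inL2_residual (G w : T -> R) (r : R) : inL2 mu G -> inL2 mu w ->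
  inL2 mu (fun t => Num.min (- G t) (w t / r)).
Proof.
move=> hG hw; apply: inL2_minr.
  have := inL2Z (-1) hG; rewrite (_ : (fun t => -1 * G t) = fun t => - G t)//.
  by apply/funext => t; rewrite mulN1r.
have := inL2Z r^-1 hw; rewrite (_ : (fun t => r^-1 * w t) = fun t => w t / r)//.
by apply/funext => t; rewrite mulrC.
Qed.

Lemma inL2_ppart (a : T -> R) : inL2 mu a -> inL2 mu (ppart a).
Proof.
move=> ha; apply: (inL2_le _ ha).
  by apply: measurable_maxr => //; exact: inL2_measurable ha.
apply: aeW => t; rewrite /ppart; case: (leP (a t) 0) => // _.
by rewrite normr0.
Qed.

End residual.

(** * Norm and inner product estimates through the embedding of [Y] *)

Section embedding.
Context {d : measure_display} {T : measurableType d} {R : realType}.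
Context (mu : {measure set T -> \bar R}) (Y : normedModType R) (e : Y -> T -> R).
Context (he : dense_embedding mu e).

Lemma embedding_inL2 y : inL2 mu (e y).
Proof. exact: he.1. Qed.

Lemma embedding_bound :
  exists2 C : R, 0 <= C & forall y, L2norm mu (e y) <= C * `|y|.
Proof.
(* The constant in [dense_embedding] carries no sign, hence the absolute value. *)
have [_ [_ [[C hC] _]]] := he; exists `|C| => // y.
rewrite -lee_fin L2normE; last exact: embedding_inL2.
by apply: (le_trans (hC y)); rewrite lee_fin ler_wpM2r// ler_norm.
Qed.

Lemma embeddingB (y1 y2 : Y) :
  {ae mu, forall t, e (y1 - y2) t = e y1 t - e y2 t}.
Proof.
have [_ [elin _]] := he; have := elin 1 (-1) y1 y2.
by rewrite scale1r scaleN1r; apply: filterS => t ->; rewrite mul1r mulN1r.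
Qed.

Lemma L2norm_embeddingB (y1 y2 : Y) :
  L2norm mu (fun t => e y1 t - e y2 t) <= L2norm mu (e (y1 - y2)).
Proof.
apply: le_L2norm; last by apply: filterS (embeddingB y1 y2) => t ->.
  by apply: inL2_measurable (inL2B (embedding_inL2 y1) (embedding_inL2 y2)).
exact: embedding_inL2.
Qed.

(** As [e] is linear only up to null sets, the identity goes through a.e. equality under the
    integral. *)
Lemma l2inner_embeddingB (a : T -> R) (y1 y2 : Y) : inL2 mu a ->
  l2inner mu a (e y1) - l2inner mu a (e y2) = l2inner mu a (e (y1 - y2)).
Proof.
move=> ha; have [h1 h2] := (embedding_inL2 y1, embedding_inL2 y2).
rewrite (ae_eq_l2innerr ha (embedding_inL2 _) (inL2B h1 h2) (embeddingB y1 y2)).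
rewrite [RHS]l2innerC -[LHS]/(_ + _) -mulN1r.
have -> : (fun t => e y1 t - e y2 t) = (fun t => e y1 t + -1 * e y2 t).
  by apply/funext => t; rewrite mulN1r.
by rewrite l2innerDl ?l2innerZl ?(l2innerC mu (e _))//; exact: inL2Z.
Qed.

End embedding.

(** * KKT errors of a safeguarded multiplier at the limit point *)

Section approximate_KKT.
Context {d : measure_display} {T : measurableType d} {R : realType}.
Context (mu : {measure set T -> \bar R}) (X Y : normedModType R).
Context (e : Y -> T -> R) (f : X -> R) (g : X -> Y).
Context (he : dense_embedding mu e).
Context (C : R) (C0 : 0 <= C) (hC : forall y, L2norm mu (e y) <= C * `|y|).
Context (xb x : X) (w W : T -> R) (r : R).
Context (r0 : 0 < r) (hw : inL2 mu w) (hW : inL2 mu W).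
Context (wW : {ae mu, forall t, 0 <= w t <= W t}).
Context (eps : R).

(** Since [r > 0], it vanishes at [t] exactly when [e (g x) t <= 0], [w t >= 0] and their product is
    0. *)
Let residual t := Num.min (- e (g x) t) (w t / r).

Context (residual_le : L2norm mu residual <= eps).
Context (gx_le : `|g x - g xb| <= eps).

Let inL2e := embedding_inL2 he.

Let inL2r : inL2 mu residual.
Proof. exact: inL2_residual. Qed.

Let dist_constraint : L2norm mu (fun t => e (g x) t - e (g xb) t) <= C * eps.
Proof.
apply: le_trans (L2norm_embeddingB he _ _) _; apply: le_trans (hC _) _.
by rewrite ler_wpM2l.
Qed.

(** In the derivative of the Lagrangian at [x], the multiplier is [w - r * residual]. The 2 collects
    the errors of that derivative and of ['d f]; [r * C * (B + 1)] comes from the residual term,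
    where [eps <= 1] bounds the norm of ['d g x] by [B + 1]; the last term comes from moving ['d g]
    from [x] to [xb]. *)
Lemma approx_stationary (B : R) : 0 <= B -> eps <= 1 ->
  (forall h, `|'d g xb h| <= B * `|h|) ->
  (forall h, `|dLagr mu e f g r x w h| <= eps * `|h|) ->
  (forall h, `|'d f x h - 'd f xb h| <= eps * `|h|) ->
  (forall h, `|'d g x h - 'd g xb h| <= eps * `|h|) ->
  forall h, `|'d f xb h + l2inner mu w (e ('d g xb h))|
    <= eps * (2 + r * C * (B + 1) + L2norm mu W * C) * `|h|.
Proof.
move=> B0 eps1 gB dL df dg h.
have lamE : ppart (fun t => w t + r * e (g x) t) = (fun t => w t + - r * residual t).
  by apply/funext => t; rewrite /ppart maxr_sub_minr// mulNr.
have hrr := inL2Z (- r) inL2r.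
have wWn : L2norm mu w <= L2norm mu W.
  apply: le_L2norm => //; first exact: inL2_measurable hw.
  by apply: filterS wW => t /andP[w0 wt]; rewrite ger0_norm// ger0_norm// (le_trans w0).
have rE : `|l2inner mu residual (e ('d g x h))| <= eps * (C * ((B + 1) * `|h|)).
  apply: le_trans (ler_norm_l2inner inL2r (inL2e _)) _.
  apply: ler_pM => //; try exact: L2norm_ge0.
  apply: le_trans (hC _) _; rewrite ler_wpM2l//.
  rewrite -(subrK ('d g xb h) ('d g x h)); apply: le_trans (ler_normD _ _) _.
  rewrite mulrDl mul1r addrC lerD//; apply: le_trans (dg h) _.
  by rewrite ler_piMl.
have wE : `|l2inner mu w (e ('d g x h)) - l2inner mu w (e ('d g xb h))|
    <= L2norm mu W * (C * (eps * `|h|)).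
  rewrite (l2inner_embeddingB he)//.
  apply: le_trans (ler_norm_l2inner hw (inL2e _)) _.
  apply: ler_pM => //; try exact: L2norm_ge0.
  by apply: le_trans (hC _) _; rewrite ler_wpM2l.
have LE : dLagr mu e f g r x w h =
    'd f x h + (l2inner mu w (e ('d g x h)) - r * l2inner mu residual (e ('d g x h))).
  by rewrite /dLagr lamE l2innerDl// l2innerZl// mulNr.
have -> : 'd f xb h + l2inner mu w (e ('d g xb h)) = dLagr mu e f g r x w h
    - ('d f x h - 'd f xb h)
    - (l2inner mu w (e ('d g x h)) - l2inner mu w (e ('d g xb h)))
    + r * l2inner mu residual (e ('d g x h)).
  by rewrite LE; ring.
have rE' : `|r * l2inner mu residual (e ('d g x h))|
    <= r * (eps * (C * ((B + 1) * `|h|))).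
  by rewrite normrM (gtr0_norm r0) ler_wpM2l// ltW.
apply: le_trans (ler_normD _ _) _.
apply: le_trans (lerD (ler_normB _ _) rE') _.
apply: le_trans (lerD (lerD (ler_normB _ _) wE) (lexx _)) _.
apply: le_trans (lerD (lerD (lerD (dL h) (df h)) (lexx _)) (lexx _)) _.
by rewrite le_eqVlt; apply/orP; left; apply/eqP; ring.
Qed.

(** The $L^2$ form of [positive_part_le_residual]. The left side is free of [eps], so arbitrarily
    small errors force exact feasibility. *)
Lemma approx_feasible : L2norm mu (ppart (e (g xb))) <= eps * (1 + C).
Proof.
have hd := inL2B (inL2e (g x)) (inL2e (g xb)).
have -> : eps * (1 + C) = eps + C * eps by ring.
apply: le_trans (lerD residual_le dist_constraint).
have nE (a : T -> R) : inL2 mu a -> L2norm mu (fun t => `|a t|) <= L2norm mu a.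
  move=> ha; apply: le_L2norm => //; first exact: inL2_measurable (inL2_norm ha).
  by apply: aeW => t; rewrite normr_id.
apply: le_trans (lerD (nE _ inL2r) (nE _ hd)).
have hs := inL2D (inL2_norm inL2r) (inL2_norm hd).
apply: le_trans (ler_L2normD (inL2_norm inL2r) (inL2_norm hd)).
apply: le_L2norm => //; first exact: inL2_measurable (inL2_ppart (inL2e _)).
apply: filterS wW => t /andP[w0 _].
rewrite ger0_norm ?le_max ?lexx ?orbT// ger0_norm ?addr_ge0//.
exact: positive_part_le_residual.
Qed.

(** Cauchy-Schwarz applied to the bound of [complementarity_le_residual]: the first factor is of
    order [eps], the second a fixed $L^2$ function. *)
Lemma approx_complementary : {ae mu, forall t, e (g xb) t <= 0} ->
  `|l2inner mu w (e (g xb))|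
    <= eps * ((1 + C) * L2norm mu (fun t => r * `|e (g xb) t| + W t)).
Proof.
move=> gb0; have hd := inL2B (inL2e (g x)) (inL2e (g xb)).
have nE (a : T -> R) : inL2 mu a -> L2norm mu (fun t => `|a t|) <= L2norm mu a.
  move=> ha; apply: le_L2norm => //; first exact: inL2_measurable (inL2_norm ha).
  by apply: aeW => t; rewrite normr_id.
have hA := inL2D (inL2_norm inL2r) (inL2_norm hd).
have hB := inL2D (inL2Z r (inL2_norm (inL2e (g xb)))) hW.
have AB := ler_norm_l2inner_dom hw (inL2e (g xb)) hA hB.
apply: (le_trans (AB _)).
  apply: filterS2 gb0 wW => t gt wt; rewrite [leRHS]ger0_norm.
    exact: complementarity_le_residual.
  have /andP[w0 wt'] := wt.
  by rewrite mulr_ge0 ?addr_ge0// ?mulr_ge0// ?(ltW r0)// (le_trans w0).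
rewrite mulrA ler_wpM2r ?L2norm_ge0//.
have -> : eps * (1 + C) = eps + C * eps by ring.
apply: le_trans (lerD residual_le dist_constraint).
apply: le_trans (lerD (nE _ inL2r) (nE _ hd)).
exact: ler_L2normD (inL2_norm inL2r) (inL2_norm hd).
Qed.

End approximate_KKT.

(** * Estimates from differentiability at a point *)

Lemma differentiable_dist_lt (R : realType) (V W : normedModType R) (f : V -> W) (a : V)
  (eps : R) : differentiable f a -> 0 < eps ->
  exists2 delta, 0 < delta & forall x, `|x - a| < delta -> `|f x - f a| <= eps.
Proof.
move=> /differentiable_continuous/cvgrPdist_le fa e0.
have /nbhs_ballP[delta d0 H] := fa _ e0.
exists delta => // x xa; rewrite distrC; apply: H.
by rewrite -ball_normE /= distrC.
Qed.

Lemma differential_bounded (R : realType) (V W : normedModType R) (f : V -> W) (a : V) :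
  differentiable f a -> exists2 B : R, 0 <= B & forall h, `|'d f a h| <= B * `|h|.
Proof.
move=> fa; have cf : {for 0, continuous 'd f a} by exact: diff_continuous.
have /linear_boundedP[M [_ HM]] := continuous_linear_bounded 0 cf.
(* Every constant strictly above [M] is a bound; this one is also nonnegative. *)
exists (`|M| + 1); first by rewrite addr_ge0.
by apply: HM; rewrite (le_lt_trans (ler_norm M))// ltrDl.
Qed.

(** * From approximate to exact multipliers, and convergence of the method *)

Lemma KKT_of_approximate (R : realType) (X Y : normedModType R)
  (d : measure_display) (T : measurableType d) (mu : {measure set T -> \bar R})
  (e : Y -> T -> R) (f : X -> R) (g : X -> Y) (W : T -> R) (xb : X) (M : R) :
  dense_embedding mu e -> inL2 mu W -> {ae mu, forall t, 0 <= W t} ->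
  (forall eps, 0 < eps -> eps <= 1 -> exists w : T -> R,
     [/\ measurable_fun [set: T] w, {ae mu, forall t, 0 <= w t <= W t},
         forall h, `|'d f xb h + l2inner mu w (e ('d g xb h))| <= eps * M * `|h| &
         `|l2inner mu w (e (g xb))| <= eps * M]) ->
  exists lambda : T -> R,
    [/\ inL2 mu lambda, {ae mu, forall t, 0 <= lambda t},
        forall h, 'd f xb h + l2inner mu lambda (e ('d g xb h)) = 0 &
        l2inner mu lambda (e (g xb)) = 0].
Proof.
move=> he hW W0 approx; have inL2e := embedding_inL2 he.
(* Each error is the absolute value of an expression affine in [v], so the bounds survive midpoints.
   The factor 1 gives the shape used by [harmonic_bound_cvg_eq0]. *)
pose S n (v : T -> R) : Prop := [/\ measurable_fun [set: T] v,
  {ae mu, forall t, 0 <= v t <= W t},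
  forall h, `|'d f xb h + l2inner mu v (e ('d g xb h))| <= n.+1%:R^-1 * `|h| &
  `|l2inner mu v (e (g xb))| <= n.+1%:R^-1 * 1].
have SL n v : S n v -> inL2 mu v by case=> mv vW _ _; exact: inL2_order_interval hW mv vW.
have Sdec m n : (m <= n)%N -> S n `<=` S m.
  move=> mn v [mv vW v1 v2]; have nm : n.+1%:R^-1 <= m.+1%:R^-1 :> R.
    by rewrite lef_pV2 ?posrE// ler_nat.
  split => //; first by move=> h; apply: le_trans (v1 h) _; rewrite ler_wpM2r.
  by apply: le_trans v2 _; rewrite ler_wpM2r.
have mid (u v c : R) : `|u| <= c -> `|v| <= c -> `|2^-1 * (u + v)| <= c.
  move=> uc vc; rewrite normrM ger0_norm ?invr_ge0//.
  by have := ler_normD u v; lra.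
have Smid n a b : S n a -> S n b -> S n (fun t => 2^-1 * (a t + b t)).
  move=> Sa Sb; have [ha hb] := (SL _ _ Sa, SL _ _ Sb); have hab := inL2D ha hb.
  case: Sa Sb => ma aW a1 a2 [mb bW b1 b2]; split.
  - exact: inL2_measurable (inL2Z _ hab).
  - apply: filterS2 aW bW => t /andP[a0 at'] /andP[b0 bt].
    by apply/andP; split; lra.
  - move=> h; rewrite l2innerZl// l2innerDl//.
    rewrite [X in `|X|](_ : _ = 2^-1 * (('d f xb h + l2inner mu a (e ('d g xb h)))
      + ('d f xb h + l2inner mu b (e ('d g xb h))))); first exact: mid.
    by field.
  - by rewrite l2innerZl// l2innerDl//; exact: mid.
have S0 n : S n !=set0.
  (* Scaled so that [eps * M] is at most $1/(n+1)$; adding 1 keeps the denominator positive and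
     [eps] at most 1. *)
  pose eps : R := n.+1%:R^-1 / (`|M| + 1).
  have M1 : 0 < `|M| + 1 by rewrite ltr_wpDl.
  have eps0 : 0 < eps by rewrite divr_gt0// invr_gt0.
  have eps1 : eps <= 1.
    rewrite ler_pdivrMr// mul1r (@le_trans _ _ 1)//; last by rewrite lerDr.
    by rewrite invf_le1// ler1n.
  have epsM : eps * M <= n.+1%:R^-1.
    rewrite /eps mulrAC ler_pdivrMr// ler_wpM2l ?invr_ge0//.
    by have := ler_norm M; lra.
  have [w [mw wW w1 w2]] := approx _ eps0 eps1; exists w; split => //.
    by move=> h; apply: le_trans (w1 h) _; rewrite ler_wpM2r.
  by rewrite mulr1 (le_trans w2).
have SW n v : S n v -> measurable_fun [set: T] v /\ {ae mu, forall t, 0 <= v t <= W t}.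
  by case.
have [lam [v [mlam lamW Sv vlam]]] := order_interval_weak_limit hW SW Sdec Smid S0.
exists lam; split.
- exact: inL2_order_interval hW mlam lamW.
- by apply: filterS lamW => t /andP[].
(* Weak convergence tested on [e ('d g xb h)], for each fixed [h]. *)
- move=> h; apply: (@harmonic_bound_cvg_eq0 _
    (fun n => 'd f xb h + l2inner mu (v n) (e ('d g xb h))) _ `|h|).
    by apply: cvgD; [exact: cvg_cst|exact: vlam].
  by move=> n; have [_ _ + _] := Sv n; exact.
- apply: (@harmonic_bound_cvg_eq0 _ (fun n => l2inner mu (v n) (e (g xb))) _ 1).
    exact: vlam.
  by move=> n; have [_ _ _] := Sv n.
Qed.

Theorem theorem6p3 (R : realType) (X Y : completeNormedModType R)
  (d : measure_display) (T : measurableType d) (mu : {measure set T -> \bar R})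
  (e : Y -> T -> R) (f : X -> R) (g : X -> Y)
  (x : nat -> X) (lam w : nat -> T -> R) (rho : nat -> R)
  (wmax : T -> R) (gamma tau : R) :
  dense_embedding mu e -> C1 f -> C1 g ->
  (* (S.0) *)
  inL2 mu (lam 0) -> 0 < rho 0 ->
  inL2 mu wmax -> {ae mu, forall t, 0 <= wmax t} ->
  1 < gamma -> 0 < tau < 1 ->
  (* (S.2): choice of w^k *)
  (forall k, inL2 mu (w k) /\ {ae mu, forall t, 0 <= w k t <= wmax t}) ->
  (* (S.2): L_{rho_k}'(x^{k+1}, w^k) -> 0 in X^* *)
  (forall eps : R, 0 < eps -> \forall k \near \oo,
     forall h : X, `|dLagr mu e f g (rho k) (x k.+1) (w k) h| <= eps * `|h|) ->
  (* (S.3): multiplier update *)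
  (forall k, lam k.+1 = ppart (fun t => w k t + rho k * e (g (x k.+1)) t)) ->
  (* (S.3): penalty update *)
  (forall k, rho k.+1 =
     if (k == 0)%N ||
        (l2norm mu (fun t => Num.min (- e (g (x k.+1)) t) (w k t / rho k))%R
         <= tau%:E * l2norm mu (fun t => Num.min (- e (g (x k)) t)
                                             (w k.-1 t / rho k.-1))%R)%E
     then rho k else gamma * rho k) ->
  (* bounded penalty parameters *)
  (exists M : R, forall k, rho k <= M) ->
  forall xbar : X,
  (* xbar is a (strong) limit point of (x^k) *)
  (exists phi : nat -> nat, {homo phi : n m / (n < m)%N >-> (n < m)%N} /\
     (x \o phi) @ \oo --> xbar) ->
  exists lambda : T -> R,
    inL2 mu lambda /\
    {ae mu, forall t, 0 <= lambda t} /\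
    (forall h : X, 'd f xbar h + l2inner mu lambda (e ('d g xbar h)) = 0) /\
    {ae mu, forall t, e (g xbar) t <= 0} /\
    l2inner mu lambda (e (g xbar)) = 0.
Proof.
move=> he [fd fC] [gd gC] _ rho0 hW W0 g1 t01 hw hL _ hrho rhoM xbar [phi [phimono phix]].
have inL2e := embedding_inL2 he.
have [C C0 hC] := embedding_bound he.
have [B B0 gB] := differential_bounded (gd xbar).
have rhoS k : rho k.+1 = rho k \/ rho k.+1 = gamma * rho k.
  by rewrite hrho; case: ifP => _; [left|right].
have [K [r [r0 rhoK]]] := bounded_growth_stationary rho0 g1 rhoS rhoM.
pose res k t := Num.min (- e (g (x k.+1)) t) (w k t / rho k).
have hres k : inL2 mu (res k) by apply: inL2_residual => //; exact: (hw k).1.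
(* The penalty rule is read at [k.+1], where its exemption for index 0 is void. A failed test would
   give [r = gamma * r], impossible as [r > 0] and [gamma > 1]. *)
have res_step k : (K <= k)%N -> L2norm mu (res k.+1) <= tau * L2norm mu (res k).
  move=> Kk; rewrite -lee_fin EFinM !L2normE//.
  have := hrho k.+1; rewrite orFb; case: ifPn => [//|_].
  rewrite !rhoK ?leqW// => /eqP; rewrite -subr_eq0 -{1}(mul1r r) -mulrBl mulf_eq0.
  by rewrite subr_eq0 lt_eqF// gt_eqF.
have res0 := linear_decay_lt t01 res_step.
have select eps : 0 < eps -> exists k, rho k = r /\
    [/\ L2norm mu (res k) <= eps, `|g (x k.+1) - g xbar| <= eps,
    forall h, `|dLagr mu e f g (rho k) (x k.+1) (w k) h| <= eps * `|h|,
    forall h, `|'d f (x k.+1) h - 'd f xbar h| <= eps * `|h| &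
    forall h, `|'d g (x k.+1) h - 'd g xbar h| <= eps * `|h|].
  move=> eps0.
  have [d1 d1_gt0 Hd1] := differentiable_dist_lt (gd xbar) eps0.
  have [d2 d2_gt0 Hd2] := fC xbar eps eps0.
  have [d3 d3_gt0 Hd3] := gC xbar eps eps0.
  pose delta := Num.min d1 (Num.min d2 d3).
  have delta0 : 0 < delta by rewrite !lt_min d1_gt0 d2_gt0.
  have [N1 _ HN1] := res0 eps eps0; have [N2 _ HN2] := hL eps eps0.
  move/cvgrPdist_lt : phix => /(_ _ delta0)[N3 _ HN3].
  (* The iterate near [xbar] is [x (phi N)], while residual and derivative at step [k] involve
     [x k.+1]; the successor makes [phi N] positive, so [k] can be its predecessor. *)
  pose N := (N1 + (N2 + (N3 + K))).+1.
  have phi_ge n : (n <= phi n)%N.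
    by elim: n => // n IH; apply: (leq_ltn_trans IH); exact: phimono.
  have phiN := phi_ge N; pose k := (phi N).-1.
  have kS : k.+1 = phi N by rewrite prednK// (leq_trans _ phiN).
  have Nk : (N1 + (N2 + (N3 + K)) <= k)%N by rewrite -ltnS kS.
  have N1k := leq_trans (leq_addr _ _) Nk; have Nk' := leq_trans (leq_addl _ _) Nk.
  have N2k := leq_trans (leq_addr _ _) Nk'.
  have Kk := leq_trans (leq_addl _ _) (leq_trans (leq_addl _ _) Nk').
  have /HN3 /= : (N3 <= N)%N.
    by rewrite /N leqW// addnA (leq_trans (leq_addr K N3)) ?leq_addl.
  rewrite -kS distrC !lt_min => /and3P[x1 x2 x3].
  exists k; split; [exact: rhoK|split].
  - exact/ltW/HN1.
  - exact: Hd1.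
  - exact: HN2.
  - exact: Hd2.
  - exact: Hd3.
have feas : {ae mu, forall t, e (g xbar) t <= 0}.
  have hp := inL2_ppart (inL2e (g xbar)).
  suff p0 : L2norm mu (ppart (e (g xbar))) = 0.
    apply: filterS (L2norm_eq0 hp p0) => t; rewrite /ppart => <-.
    by rewrite le_max lexx.
  (* Errors below [eps / (1 + C)] make the bound of [approx_feasible] equal to [eps]. *)
  apply/eqP; rewrite eq_le L2norm_ge0 andbT; apply/ler_addgt0Pr => eps eps0.
  have C1_gt0 : 0 < 1 + C by rewrite ltr_wpDr.
  have [k [rk [resk gk _ _ _]]] := select _ (divr_gt0 eps0 C1_gt0).
  rewrite add0r -(divfK (lt0r_neq0 C1_gt0) eps).
  have [hwk wWk] := hw k; rewrite /res rk in resk.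
  exact: (approx_feasible he C0 hC r0 hwk wWk resk gk).
(* The factors from [approx_stationary] and [approx_complementary] are independent of [eps] and [k];
   being nonnegative, both are covered by [M1 + M2]. *)
pose M1 := 2 + r * C * (B + 1) + L2norm mu wmax * C.
pose M2 := (1 + C) * L2norm mu (fun t => r * `|e (g xbar) t| + wmax t).
have M10 : 0 <= M1 by rewrite !addr_ge0 ?mulr_ge0 ?addr_ge0 ?L2norm_ge0// ltW.
have M20 : 0 <= M2 by rewrite mulr_ge0 ?addr_ge0 ?L2norm_ge0.
have [|l [hl l0 stat comp]] :=
    @KKT_of_approximate _ _ _ _ _ mu e f g wmax xbar (M1 + M2) he hW W0; last first.
  by exists l.
move=> eps eps0 eps1; have [k [rk [resk gk Lk fk gk']]] := select _ eps0.
have [hwk wWk] := hw k; rewrite /res rk in resk; rewrite rk in Lk.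
exists (w k); split => //; first exact: inL2_measurable hwk.
  move=> h; apply: le_trans (_ : eps * M1 * `|h| <= _).
    exact: (approx_stationary he C0 hC r0 hwk hW wWk resk B0 eps1 gB Lk fk gk').
  by rewrite ler_wpM2r// ler_wpM2l ?(ltW eps0)// lerDl.
apply: le_trans (approx_complementary he C0 hC r0 hwk hW wWk resk gk feas) _.
by rewrite ler_wpM2l ?(ltW eps0)// lerDr.
Qed.
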